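(* Let $\mathbf A=\langle A,+,',1\rangle$ be a 0-commutative orthogroupoid and $e$ a central element of $\mathbf A$. Then $\mathbf A\cong[\mathbf 0,\mathbf e]\times[\mathbf 0,\mathbf e']$, where for a central element $c$, $[\mathbf 0,\mathbf c]$ denotes the algebra $\langle[0,c],+,{}^{c},c\rangle$ with universe $[0,c]=\{x\in A:x+c=c+x=c\}$, binary operation the restriction of $+$, unary operation $x^{c}=c\cdot x'$, and constant $c$.
   Context: An orthogroupoid is an algebra $\langle A,+,',1\rangle$ of type $(2,1,0)$, with $0:=1'$, satisfying: (a) $x''\approx x$; (b) $0+x\approx x$ and $x+1\approx 1$; (c) $x+x'\approx 1$; (d) for all $x,z$: if $x+z=z$ and $x'+z=z$ then $z=1$; (e) $(((z+y)'+(z+x))'+(z+y)')+z'\approx z'$; (f) $x+(x+y)\approx x+y$ and $y+(x+y)\approx x+y$. It is 0-commutative if it satisfies $x+0\approx 0+x$. Define $x\cdot y:=(x'+y')'$. An element $e\in A$ is central if the principal congruences $\theta(e,0)$ and $\theta(e,1)$ form a pair of factor congruences of $\mathbf A$ (their intersection is the identity relation and their composition is $A\times A$). *)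

(* Defs.v *)
From mathcomp Require Import ssreflect ssrfun ssrbool.

Set Implicit Arguments.
Unset Strict Implicit.
Unset Printing Implicit Defensive.

Declare Scope alg_scope.
Delimit Scope alg_scope with alg.

(* Algebras of type (2,1,0). *)
Record algebra := Algebra {
  carrier :> Type;
  add : carrier -> carrier -> carrier;
  compl : carrier -> carrier;
  one : carrier
}.

Arguments one {a}.
Bind Scope alg_scope with carrier.

Definition zero (A : algebra) : A := compl (@one A).
Arguments zero {A}.

Notation "x + y" := (add x y) : alg_scope.
Notation "x ^'" := (compl x) (at level 1, format "x ^'") : alg_scope.
Notation "0" := zero : alg_scope.
Notation "1" := one : alg_scope.
Local Open Scope alg_scope.

Definition meet (A : algebra) (x y : A) : A := (x^' + y^')^'.

Record orthogroupoid (A : algebra) : Prop := Orthogroupoid {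
  complK : forall x : A, x^'^' = x;
  add0x : forall x : A, 0 + x = x;
  addx1 : forall x : A, x + 1 = 1;
  addxC : forall x : A, x + x^' = 1;
  add_orth : forall x z : A, x + z = z -> x^' + z = z -> z = 1;
  add_antitone : forall x y z : A,
    (((z + y)^' + (z + x))^' + (z + y)^') + z^' = z^';
  add_absl : forall x y : A, x + (x + y) = x + y;
  add_absr : forall x y : A, y + (x + y) = x + y
}.

Definition zero_commutative (A : algebra) : Prop :=
  forall x : A, x + 0 = 0 + x.

Record congruence (A : algebra) (R : A -> A -> Prop) : Prop := Congruence {
  cong_refl : forall x, R x x;
  cong_sym : forall x y, R x y -> R y x;
  cong_trans : forall x y z, R x y -> R y z -> R x z;
  cong_add : forall x1 x2 y1 y2, R x1 x2 -> R y1 y2 -> R (x1 + y1) (x2 + y2);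
  cong_compl : forall x y, R x y -> R x^' y^'
}.

Definition principal_congruence (A : algebra) (a b x y : A) : Prop :=
  forall R : A -> A -> Prop, congruence R -> R a b -> R x y.

Definition factor_congruences (A : algebra) (R S : A -> A -> Prop) : Prop :=
  [/\ congruence R, congruence S,
      forall x y, R x y /\ S x y <-> x = y
    & forall x y, exists2 z, R x z & S z y].

Definition central (A : algebra) (e : A) : Prop :=
  factor_congruences (principal_congruence e 0) (principal_congruence e 1).

Definition in_interval (A : algebra) (c x : A) : Prop :=
  x + c = c /\ c + x = c.

Definition interval (A : algebra) (c : A) : Type :=
  {x : A | in_interval c x}.

Lemma principal_congruenceP (A : algebra) (a b : A) :
  congruence (principal_congruence a b).
Proof.
split.
- by move=> x R cR _; apply: (cong_refl cR).
- by move=> x y h R cR Rab; apply: (cong_sym cR); apply: h.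
- by move=> x y z h k R cR Rab; apply: (cong_trans cR (h R cR Rab) (k R cR Rab)).
- by move=> x1 x2 y1 y2 h k R cR Rab;
     apply: (cong_add cR (h R cR Rab) (k R cR Rab)).
- by move=> x y h R cR Rab; apply: (cong_compl cR); apply: h.
Qed.

Lemma add1x (A : algebra) (hA : orthogroupoid A) (x : A) : 1 + x = 1.
Proof. by apply: (add_orth hA (x := 1)); rewrite ?add_absl // add0x. Qed.

Lemma in_intervalP (A : algebra) (hA : orthogroupoid A) (c : A)
    (hc : central c) (x : A) :
  in_interval c x <-> principal_congruence c 0 x 0.
Proof.
case: hc => cR cS RS_id _.
have Rc0 : principal_congruence c 0 c 0 by move=> R _ h.
have Sc1 : principal_congruence c 1 c 1 by move=> R _ h.
split=> [[_ cx]|Rx0].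
  have := cong_add cR (cong_sym cR Rc0) (cong_refl cR x).
  by rewrite (add0x hA) cx => h; apply: (cong_trans cR h Rc0).
have S1c := cong_sym cS Sc1.
split; apply/RS_id; split.
- by have := cong_add cR Rx0 (cong_refl cR c); rewrite (add0x hA).
- have := cong_add cS (cong_refl cS x) Sc1; rewrite (addx1 hA) => h.
  exact: (cong_trans cS h S1c).
- have := cong_add cR Rc0 Rx0; rewrite (add0x hA) => h.
  exact: (cong_trans cR h (cong_sym cR Rc0)).
- have := cong_add cS Sc1 (cong_refl cS x); rewrite (add1x hA) => h.
  exact: (cong_trans cS h S1c).
Qed.

Lemma interval_add_closed (A : algebra) (hA : orthogroupoid A) (c : A)
    (hc : central c) (x y : A) :
  in_interval c x -> in_interval c y -> in_interval c (x + y).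
Proof.
move=> /(in_intervalP hA hc) hx /(in_intervalP hA hc) hy.
apply/(in_intervalP hA hc).
have := cong_add (principal_congruenceP c 0) hx hy.
by rewrite (add0x hA).
Qed.

Lemma interval_compl_closed (A : algebra) (hA : orthogroupoid A) (c : A)
    (hc : central c) (x : A) :
  in_interval c x -> in_interval c (meet c x^').
Proof.
move=> _; apply/(in_intervalP hA hc).
have cR := principal_congruenceP c 0.
have Rc0 : principal_congruence c 0 c 0 by move=> R _ h.
have := cong_compl cR (cong_add cR (cong_compl cR Rc0) (cong_refl cR x^'^')).
by rewrite /zero (complK hA 1) (add1x hA).
Qed.

Lemma interval_one_closed (A : algebra) (hA : orthogroupoid A) (c : A)
    (hc : central c) : in_interval c c.
Proof. by apply/(in_intervalP hA hc) => R _ h. Qed.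

Definition interval_algebra (A : algebra) (hA : orthogroupoid A) (c : A)
    (hc : central c) : algebra := {|
  carrier := interval c;
  add := fun x y => exist _ (proj1_sig x + proj1_sig y)
    (interval_add_closed hA hc (proj2_sig x) (proj2_sig y));
  compl := fun x => exist _ (meet c (proj1_sig x)^')
    (interval_compl_closed hA hc (proj2_sig x));
  one := exist _ c (interval_one_closed hA hc)
|}.

Lemma central_compl (A : algebra) (hA : orthogroupoid A) (e : A) :
  central e -> central e^'.
Proof.
have sw (a b x y : A) :
    principal_congruence a^' b^' x y <-> principal_congruence a b x y.
  split=> h R cR Rab; apply: h => //; first exact: (cong_compl cR).
  by have := cong_compl cR Rab; rewrite !(complK hA).
have sw0 x y : principal_congruence e^' 0 x y <-> principal_congruence e 1 x y.
  exact: sw.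
have sw1 x y : principal_congruence e^' 1 x y <-> principal_congruence e 0 x y.
  by rewrite -(complK hA 1); apply: sw.
case=> cR cS RS_id RS_comp; split; try exact: principal_congruenceP.
- move=> x y; split=> [[/sw0 h /sw1 k]|/RS_id [h k]]; first exact/RS_id.
  by split; [apply/sw0 | apply/sw1].
- move=> x y; have [z Rz Sz] := RS_comp y x.
  by exists z; [apply/sw0; apply: (cong_sym cS) | apply/sw1; apply: (cong_sym cR)].
Qed.

Definition product_algebra (A B : algebra) : algebra := {|
  carrier := A * B;
  add := fun x y => (x.1 + y.1, x.2 + y.2);
  compl := fun x => (x.1^', x.2^');
  one := (1, 1)
|}.

Definition isomorphic (A B : algebra) : Prop :=
  exists f : A -> B,
    [/\ bijective f,
        forall x y, f (x + y) = f x + f y,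
        forall x, f x^' = (f x)^'
      & f 1 = 1].

(* Main.v *)
Require Import Defs.
From Stdlib Require Import ProofIrrelevance.
From mathcomp Require Import ssreflect ssrfun ssrbool.

Set Implicit Arguments.
Unset Strict Implicit.
Unset Printing Implicit Defensive.

Local Open Scope alg_scope.

(** For central [c], the interval [[0, c]] is the class of [0] modulo
    [theta(c, 0)], and it meets each class of [theta(c, 1)] in exactly one point:
    the class of [x] is represented by [meet c x].  So [meet c] is a morphism
    onto [[0, c]] with kernel [theta(c, 1)].  As [theta(e^', 1) = theta(e, 0)],
    pairing [meet e] with [meet e^'] is injective; its inverse is [+], where
    0-commutativity gives [a + b = a + 0 = a] modulo [theta(e, 1)]. *)

Lemma principal_congruence_gen (A : algebra) (a b : A) :
  principal_congruence a b a b.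
Proof. by move=> R _. Qed.
Arguments principal_congruence_gen {A} a b.

Lemma principal_congruence_compl (A : algebra) (hA : orthogroupoid A)
    (a b x y : A) :
  principal_congruence a^' b^' x y <-> principal_congruence a b x y.
Proof.
split=> h R cR Rab; apply: h => //; first exact: (cong_compl cR).
by have := cong_compl cR Rab; rewrite !(complK hA).
Qed.

Lemma principal_congruence_compl0 (A : algebra) (hA : orthogroupoid A)
    (e x y : A) :
  principal_congruence e^' 0 x y <-> principal_congruence e 1 x y.
Proof. exact: principal_congruence_compl. Qed.

Lemma principal_congruence_compl1 (A : algebra) (hA : orthogroupoid A)
    (e x y : A) :
  principal_congruence e^' 1 x y <-> principal_congruence e 0 x y.
Proof. by rewrite -(complK hA 1); apply: principal_congruence_compl. Qed.

(** Modulo [theta(c, 1)] the element [c^'] becomes [0], so [(c^' + x^')^'] collapses to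
    [x^'^' = x]. *)
Lemma meet_cong1 (A : algebra) (hA : orthogroupoid A) (c x : A) :
  principal_congruence c 1 (meet c x) x.
Proof.
have cS := principal_congruenceP c 1.
have := cong_compl cS (cong_add cS
  (cong_compl cS (principal_congruence_gen c 1)) (cong_refl cS x^')).
by rewrite (add0x hA) (complK hA).
Qed.
Arguments meet_cong1 {A} hA c x.

(** Modulo [theta(c, 0)] the element [c^'] becomes [1], which absorbs [x^']; hence [meet c x] is
    congruent to [1^' = 0]. *)
Lemma in_interval_meet (A : algebra) (hA : orthogroupoid A) (c : A)
    (hc : central c) (x : A) :
  in_interval c (meet c x).
Proof.
apply/(in_intervalP hA hc); have cR := principal_congruenceP c 0.
have := cong_compl cR (cong_add cR
  (cong_compl cR (principal_congruence_gen c 0)) (cong_refl cR x^')).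
by rewrite /zero (complK hA 1) (add1x hA).
Qed.

Definition interval_proj (A : algebra) (hA : orthogroupoid A) (c : A)
    (hc : central c) (x : A) : interval_algebra hA hc :=
  exist _ (meet c x) (in_interval_meet hA hc x).

(** Both points are congruent to [0], hence to each other, modulo [theta(c, 0)], and the two
    congruences intersect in equality. Proof irrelevance identifies the membership proofs. *)
Lemma interval_cong1_inj (A : algebra) (hA : orthogroupoid A) (c : A)
    (hc : central c) (a b : interval_algebra hA hc) :
  principal_congruence c 1 (proj1_sig a) (proj1_sig b) -> a = b.
Proof.
case: a b => [a ha] [b hb] /= Sab; apply: subset_eq_compat.
have cR := principal_congruenceP c 0.
have /(in_intervalP hA hc) Ra := ha; have /(in_intervalP hA hc) Rb := hb.
case: (hc) => _ _ RS_id _; apply/RS_id; split=> //.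
exact: (cong_trans cR Ra (cong_sym cR Rb)).
Qed.

(** Reduces every equation on projections to a congruence modulo [theta(c, 1)], so no identity for
    [meet] has to be computed. *)
Lemma interval_projE (A : algebra) (hA : orthogroupoid A) (c : A)
    (hc : central c) (x : A) (a : interval_algebra hA hc) :
  principal_congruence c 1 x (proj1_sig a) -> interval_proj hA hc x = a.
Proof.
move=> Sxa; apply: interval_cong1_inj.
exact: (cong_trans (principal_congruenceP c 1) (meet_cong1 hA c x)).
Qed.

Section IntervalProjMorphism.

Variables (A : algebra) (hA : orthogroupoid A) (c : A) (hc : central c).

Let cS := principal_congruenceP c 1.
Let x_meet (x : A) := cong_sym cS (meet_cong1 hA c x).

Lemma interval_proj_add (x y : A) :
  interval_proj hA hc (x + y) = interval_proj hA hc x + interval_proj hA hc y.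
Proof. by apply: interval_projE; apply: (cong_add cS). Qed.

Lemma interval_proj_compl (x : A) :
  interval_proj hA hc x^' = (interval_proj hA hc x)^'.
Proof.
apply: interval_projE => /=.
(* The complement in the interval is [meet c (meet c x)^'], so each of the two meets is removed by
   [x_meet]. *)
exact: (cong_trans cS (cong_compl cS (x_meet x)) (x_meet _)).
Qed.

Lemma interval_proj_one : interval_proj hA hc 1 = 1.
Proof.
by apply: interval_projE; apply: (cong_sym cS); apply: principal_congruence_gen.
Qed.

End IntervalProjMorphism.

Theorem theorem3p8 (A : algebra) (hA : orthogroupoid A)
    (h0 : zero_commutative A) (e : A) (he : central e) :
  isomorphic A
    (product_algebra (interval_algebra hA he)
                     (interval_algebra hA (central_compl hA he))).
Proof.
have he' := central_compl hA he.
have cR := principal_congruenceP e 0; have cS := principal_congruenceP e 1.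
exists (fun x => (interval_proj hA he x,
                  interval_proj hA (central_compl hA he) x)); split.
- exists (fun ab => proj1_sig ab.1 + proj1_sig ab.2) => [x|[a b]] /=.
    have /(in_intervalP hA he) R0 := in_interval_meet hA he x.
    have /(in_intervalP hA he')/(principal_congruence_compl0 hA) S0 :=
      in_interval_meet hA he' x.
    have Rx : principal_congruence e 0 (meet e^' x) x.
      by apply/(principal_congruence_compl1 hA); apply: meet_cong1.
    (* The equation [meet e x + meet e^' x = x] is checked modulo both factor congruences: the left
       summand vanishes modulo [theta(e, 0)], the right one modulo [theta(e, 1)]. *)
    case: (he) => _ _ RS_id _; apply/RS_id; split.
      by have := cong_add cR R0 Rx; rewrite (add0x hA).
    have := cong_add cS (meet_cong1 hA e x) S0.
    by rewrite h0 (add0x hA).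
  congr pair; apply: interval_projE.
    have /(in_intervalP hA he')/(principal_congruence_compl0 hA) S0 := proj2_sig b.
    have := cong_add cS (cong_refl cS (proj1_sig a)) S0.
    by rewrite h0 (add0x hA).
  (* For the second component, [a] vanishes modulo [theta(e^', 1) = theta(e, 0)], leaving
     [0 + b = b]. *)
  apply/(principal_congruence_compl1 hA).
  have /(in_intervalP hA he) R0 := proj2_sig a.
  have := cong_add cR R0 (cong_refl cR (proj1_sig b)).
  by rewrite (add0x hA).
- by move=> x y; rewrite !interval_proj_add.
- by move=> x; rewrite !interval_proj_compl.
- by rewrite !interval_proj_one.
Qed.
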